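(* Let $\alpha\in(0,1]$ and suppose that the envelope conditions, the Hölder stability condition and the parameter compactness condition of the context are satisfied. Then, for every $n\in\mathbb N$, $r\ge0$, $\alpha'\in[0,\alpha)$ and $\varepsilon>0$, there exists an envelope-neural operator $\Phi_n\in\mathcal{EN}^{\mathrm{ReLU}}_{C_\kappa,C_\kappa}$ with $$\sup_{f\in B_{C^\alpha_\kappa}(r)}\|I_nf-\Phi_nf\|_{\alpha',\kappa}<\varepsilon .$$
   Context: **Function spaces.** $|\cdot|$ is the Euclidean norm on $\mathbb R^d$. $\kappa:\mathbb R^d\to(0,\infty)$ is bounded continuous with $\sup_x\sup_{|y|\le1}\kappa(x)/\kappa(x-y)<\infty$. $C_\kappa$ is the space of continuous $f:\mathbb R^d\to\mathbb R$ with $\|f\|_\kappa:=\sup_x|f(x)|\kappa(x)<\infty$, ordered pointwise and endowed with the mixed topology (strongest locally convex topology coinciding on $\|\cdot\|_\kappa$-bounded sets with uniform convergence on compacts); $f_n\to f$ in it iff $\sup_n\|f_n\|_\kappa<\infty$ and $\|f-f_n\|_{\infty,K}:=\sup_{K}|f-f_n|\to0$ for all compact $K\subset\mathbb R^d$. All limits in $C_\kappa$ are in this sense. Put $\bar\kappa(x,y):=\frac{2\kappa(x)\kappa(y)}{\kappa(x)+\kappa(y)}$. For $\alpha\in[0,1]$, $$\|f\|_{\alpha,\kappa}:=\max\Big\{\sup_x|f(x)|\kappa(x),\ \sup_{x\ne y}\frac{|f(x)-f(y)|}{|x-y|^\alpha}\bar\kappa(x,y)\Big\},$$ $C^\alpha_\kappa$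 is the space of $f:\mathbb R^d\to\mathbb R$ with $\|f\|_{\alpha,\kappa}<\infty$ (with $C^0_\kappa=C_\kappa$ as sets), and $B_{C^\alpha_\kappa}(r)$, $B_{C_\kappa}(r)$ are the closed balls of radius $r$ for $\|\cdot\|_{\alpha,\kappa}$, $\|\cdot\|_\kappa$. $\mathrm{Lip}_b(r)$ is the set of $r$-Lipschitz $f:\mathbb R^d\to\mathbb R$ with $\|f\|_\infty\le r$; $C_b^\infty$ is the space of bounded smooth functions with all derivatives bounded; $(\tau_xf)(y):=f(x+y)$; $B_{\mathbb R^d}(\delta):=\{|x|\le\delta\}$. **Operators.** $\Lambda$ is an index set, $I_{n,\lambda}:C_\kappa\to C_\kappa$ ($n\in\mathbb N,\lambda\in\Lambda$) are operators, $\eta,\eta_n:\Lambda\to[0,\infty]$, and $(h_n)\subset(0,\infty)$ with $h_n\to0$. Define $(I_nf)(x):=\sup_{\lambda\in\Lambda}\big((I_{n,\lambda}f)(x)-\eta_n(\lambda)h_n\big)$. Let $A_\lambda f:=\lim_{n\to\infty}\frac{I_{n,\lambda}f-f}{h_n}$ with domain $D(A_\lambda)$ the set of $f\in C_\kappa$ for which the limit exists, and $I'(0)f:=\lim_{n\to\infty}\frac{I_nf-f}{h_n}$ when it exists in $C_\kappa$. For $t\ge0$: $k_n^t:=\max\{k\in\mathbb N_0:kh_n\le t\}$, $I(\pi_n^t)f:=I_n^{k_n^t}f$. Suprema of functions are pointwise. **Envelope conditions.** Either (i)–(vii), or (i)–(vi) and (vii'), hold: (i) for every $n$ there is $\lambda_{0,n}\in\Lambda$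 with $\eta_n(\lambda_{0,n})=0$; (ii) all $I_{n,\lambda}$ are linear and monotone; (iii) there is $\omega\ge0$ with $\|I_{n,\lambda}f\|_\kappa\le e^{\omega h_n}\|f\|_\kappa$ for all $n,\lambda$, $f\in C_\kappa$; (iv) for every $\varepsilon>0$ there are $\delta>0$, $n_0\in\mathbb N$ with $I_{n,\lambda}(\tau_xf)\le\tau_x(I_{n,\lambda}f)+\frac{r\varepsilon h_n}{\kappa}$ for all $n\ge n_0$, $r\ge0$, $f\in\mathrm{Lip}_b(r)$, $x\in B_{\mathbb R^d}(\delta)$, $\lambda\in\Lambda$; (v) for all $\varepsilon>0$, $r,T\ge0$, compact $K\subset\mathbb R^d$ there are $c\ge0$ and compact $K'\subset\mathbb R^d$ with $\|I(\pi_n^t)f-I(\pi_n^t)g\|_{\infty,K}\le c\|f-g\|_{\infty,K'}+\varepsilon$ for all $t\in[0,T]$, $n\in\mathbb N$, $f,g\in B_{C_\kappa}(r)$; (vi) $I_{n,\lambda}:\mathrm{Lip}_b(r)\to\mathrm{Lip}_b(e^{\omega h_n}r)$ for all $n,\lambda$, $r\ge0$; (vii) $I'(0)f\in C_\kappa$ exists for all $f\in C_b^\infty$; (vii') $C_b^\infty\subset D(A_\lambda)$ for all $\lambda$, and for every $f\in C_b^\infty$ there are $c\ge0$, $n_0\in\mathbb N$, $\Lambda_0\subset\Lambda$ such that: (a) $\sup_{\lambda\in\Lambda}(I_{n,\lambda}f-\eta_n(\lambda)h_n)=\sup_{\lambda\in\Lambda_0}(I_{n,\lambda}f-\eta_n(\lambda)h_n)$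 for all $n\ge n_0$; (b) $\sup_{\lambda\in\Lambda}(A_\lambda f-\eta(\lambda))=\sup_{\lambda\in\Lambda_0}(A_\lambda f-\eta(\lambda))$; (c) $\sup_n\sup_{\lambda\in\Lambda_0}\eta_n(\lambda)<\infty$, $\sup_{\lambda\in\Lambda_0}\|I_{n,\lambda}f-f\|_\kappa\le ch_n$ for $n\ge n_0$, $\lim_{n}\sup_{\lambda\in\Lambda_0}\big\|\frac{I_{n,\lambda}f-f}{h_n}-A_\lambda f\big\|_{\infty,K}=0$ for all compact $K$, and $\lim_n\sup_{\lambda\in\Lambda_0}|\eta_n(\lambda)-\eta(\lambda)|=0$. **Hölder stability condition.** $\|I_{n,\lambda}f\|_{\alpha,\kappa}\le e^{\omega h_n}\|f\|_{\alpha,\kappa}$ for all $n\in\mathbb N$, $\lambda\in\Lambda$, $f\in C^\alpha_\kappa$. **Parameter compactness condition.** For every $r\ge0$ there is a totally bounded metric space $(\Lambda_r,d_r)$ with $\Lambda_r\subset\Lambda$ such that $\Lambda_{r,n}:=\Lambda_r\cap\{\eta_n<\infty\}$ satisfies $\sup_{\lambda\in\Lambda}(I_{n,\lambda}f-\eta_n(\lambda)h_n)=\sup_{\lambda\in\Lambda_{r,n}}(I_{n,\lambda}f-\eta_n(\lambda)h_n)$ for all $n\in\mathbb N$, $f\in B_{C^\alpha_\kappa}(r)$. For every $r\ge0$, $\varepsilon>0$ there is $\delta>0$ with $\|(I_{n,\lambda_1}f-\eta_n(\lambda_1)h_n)-(I_{n,\lambda_2}f-\eta_n(\lambda_2)h_n)\|_\kappa<\varepsilon$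 for all $n\in\mathbb N$, $f\in B_{C^\alpha_\kappa}(r)$ and $\lambda_1,\lambda_2\in\Lambda_{r,n}$ with $d_r(\lambda_1,\lambda_2)<\delta$. Moreover $\lambda_{0,n}\in\Lambda_r$ for all $n\in\mathbb N$. **Envelope-neural operators.** For $n\in\mathbb N$, an envelope-neural operator is a map $\Phi_n:C_\kappa\to C_\kappa$, $f\mapsto\varphi\big((I_{n,\lambda_0}f)(\cdot),(I_{n,\lambda_1}f)(\cdot),\dots,(I_{n,\lambda_M}f)(\cdot)\big)$ with $M\in\mathbb N$, $\lambda_0:=\lambda_{0,n}$, $\lambda_1,\dots,\lambda_M\in\Lambda$, and $\varphi:\mathbb R^{M+1}\to\mathbb R$ a feedforward ReLU neural network (finite composition of affine maps and coordinatewise ReLU $s\mapsto\max(s,0)$). The set of all of these is $\mathcal{EN}^{\mathrm{ReLU}}_{C_\kappa,C_\kappa}$. *)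

(* Defs.v *)
From mathcomp Require Import all_boot all_order all_algebra.
From mathcomp Require Import all_classical all_reals all_analysis.
Set Implicit Arguments.
Unset Strict Implicit.
Unset Printing Implicit Defensive.
Import Order.TTheory GRing.Theory Num.Theory.
Import numFieldNormedType.Exports.
Local Open Scope classical_set_scope.
Local Open Scope ring_scope.

Section FunctionSpaces.
Context {R : realType} {d : nat}.
Local Notation V := 'rV[R]_d.
Implicit Types (f g : V -> R) (kappa : V -> R) (K : set V) (alpha r : R).

(* The library norm on 'rV is the sup norm; it induces the same topology. *)
Definition enorm (x : V) : R := Num.sqrt (\sum_i x ord0 i ^+ 2).

Definition weight kappa : Prop :=
  [/\ forall x, 0 < kappa x,
      continuous kappa,
      exists M : R, forall x, kappa x <= M
    & exists C : R, forall x y, enorm y <= 1 -> kappa x / kappa (x - y) <= C].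

Definition knorm kappa f : \bar R :=
  ereal_sup [set (`|f x| * kappa x)%:E | x in [set: V]].

Definition Ck kappa : set (V -> R) :=
  [set f | continuous f /\ (knorm kappa f < +oo)%E].

Definition Ck_ball kappa r : set (V -> R) :=
  [set f | Ck kappa f /\ (knorm kappa f <= r%:E)%E].

(* The maximum with 0 makes the seminorm of the empty compact set equal to 0
   rather than -oo. *)
Definition supnorm K f : \bar R :=
  maxe 0%E (ereal_sup [set `|f x|%:E | x in K]).

(* Sequential convergence in the mixed topology. *)
Definition Ck_cvg kappa (u : nat -> V -> R) f : Prop :=
  [/\ forall n, Ck kappa (u n),
      Ck kappa f,
      (ereal_sup [set knorm kappa (u n) | n in [set: nat]] < +oo)%E
    & forall K, compact K -> supnorm K (f \- u n) @[n --> \oo] --> 0%E].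

(* Limits are unique (take K a singleton); junk value 0 if u does not converge. *)
Definition Ck_lim kappa (u : nat -> V -> R) : V -> R :=
  xget (cst 0) [set f | Ck_cvg kappa u f].

Definition kbar kappa (x y : V) : R :=
  2 * kappa x * kappa y / (kappa x + kappa y).

Definition holder_norm kappa alpha f : \bar R :=
  maxe (knorm kappa f)
    (ereal_sup [set (`|f p.1 - f p.2| / (enorm (p.1 - p.2) `^ alpha)
                     * kbar kappa p.1 p.2)%:E
               | p in [set p : V * V | p.1 != p.2]]).

Definition holder_space kappa alpha : set (V -> R) :=
  if alpha == 0 then Ck kappa
  else [set f | (holder_norm kappa alpha f < +oo)%E].

Definition holder_ball kappa alpha r : set (V -> R) :=
  [set f | holder_space kappa alpha f /\ (holder_norm kappa alpha f <= r%:E)%E].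

Definition Lip_b r : set (V -> R) :=
  [set f | (forall x y, `|f x - f y| <= r * enorm (x - y)) /\
           (forall x, `|f x| <= r)].

(* Iterated partial derivative along the coordinates listed in s. *)
Definition iter_partial (s : seq 'I_d) f : V -> R :=
  foldr (fun i g => 'D_(delta_mx ord0 i) g) f s.

Definition Cb_infty : set (V -> R) :=
  [set f | forall s : seq 'I_d,
    [/\ forall x i, derivable (iter_partial s f) x (delta_mx ord0 i),
        continuous (iter_partial s f)
      & exists M : R, forall x, `|iter_partial s f x| <= M]].

Definition shift_fun (x : V) f : V -> R := fun y => f (x + y).

End FunctionSpaces.

Section Operators.
Context {R : realType} {d : nat} {Lambda : Type}.
Local Notation V := 'rV[R]_d.
(* Operators on Ck are total functions on V -> R; only their values on Ck are
   constrained by the hypotheses below. *)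
Variables (kappa : V -> R) (I : nat -> Lambda -> (V -> R) -> (V -> R)).
Variables (eta : Lambda -> \bar R) (etan : nat -> Lambda -> \bar R).
Variable (h : nat -> R).
Implicit Types (f g : V -> R) (l : Lambda) (L : set Lambda) (n : nat).

(* Extended real valued: the terms with etan n l = +oo are -oo. *)
Definition step_sup L n f (x : V) : \bar R :=
  ereal_sup [set ((I n l f x)%:E - etan n l * (h n)%:E)%E | l in L].

Definition envelope n f : V -> R := fun x => fine (step_sup [set: Lambda] n f x).

Definition diff_quot l f n : V -> R := fun x => (I n l f x - f x) / h n.

Definition gen_dom l : set (V -> R) :=
  [set f | Ck kappa f /\ exists g, Ck_cvg kappa (diff_quot l f) g].

Definition gen l f : V -> R := Ck_lim kappa (diff_quot l f).

Definition gen_sup L f (x : V) : \bar R :=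
  ereal_sup [set ((gen l f x)%:E - eta l)%E | l in L].

Definition nsteps n (t : R) : nat := Num.truncn (t / h n).

Lemma nstepsP n (t : R) : 0 < h n -> 0 <= t ->
  forall k : nat, (k <= nsteps n t)%N = (k%:R * h n <= t).
Proof.
move=> h0 t0 k; have q0 : 0 <= t / h n by apply: divr_ge0 => //; exact: ltW.
by rewrite /nsteps (truncn_ge_nat _ q0) ler_pdivlMr.
Qed.

Definition iter_envelope n (t : R) f : V -> R := iter (nsteps n t) (envelope n) f.

Definition operator_setting : Prop :=
  [/\ forall n l f, Ck kappa f -> Ck kappa (I n l f),
      (forall l, 0 <= eta l)%E,
      (forall n l, 0 <= etan n l)%E,
      forall n, 0 < h n
    & h n @[n --> \oo] --> 0].

Record base_conditions (omega : R) (lam0 : nat -> Lambda) : Prop := {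
  base_penalty : forall n, etan n (lam0 n) = 0%E;
  base_linear : forall n l (a b : R) f g, Ck kappa f -> Ck kappa g ->
    I n l (fun x => a * f x + b * g x) =
    (fun x => a * I n l f x + b * I n l g x);
  base_monotone : forall n l f g, Ck kappa f -> Ck kappa g ->
    (forall x, f x <= g x) -> forall x, I n l f x <= I n l g x;
  base_omega_ge0 : 0 <= omega;
  base_bound : forall n l f, Ck kappa f ->
    (knorm kappa (I n l f) <= (expR (omega * h n))%:E * knorm kappa f)%E;
  base_shift : forall eps : R, 0 < eps ->
    exists delta : R, 0 < delta /\ exists n0 : nat,
    forall n, (n0 <= n)%N -> forall (r : R), 0 <= r ->
    forall f, Lip_b r f -> forall x : V, enorm x <= delta -> forall l (y : V),
      I n l (shift_fun x f) y
      <= shift_fun x (I n l f) y + r * eps * h n / kappa y;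
  base_equicontinuity : forall eps r T : R, 0 < eps -> 0 <= r -> 0 <= T ->
    forall K : set V, compact K ->
    exists c : R, 0 <= c /\ exists K' : set V, compact K' /\
    forall (t : R), 0 <= t <= T -> forall n f g,
      Ck_ball kappa r f -> Ck_ball kappa r g ->
      (supnorm K (iter_envelope n t f \- iter_envelope n t g)%R
       <= c%:E * supnorm K' (f \- g)%R + eps%:E)%E;
  base_lipschitz : forall n l (r : R) f, 0 <= r -> Lip_b r f ->
    Lip_b (expR (omega * h n) * r) (I n l f)
}.

Definition envelope_derivative : Prop :=
  forall f, Cb_infty f ->
  exists g, Ck_cvg kappa (fun n x => (envelope n f x - f x) / h n) g.

Definition generator_condition : Prop :=
  (forall l, Cb_infty `<=` gen_dom l) /\
  forall f, Cb_infty f ->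
  exists (c : R) (n0 : nat) (L0 : set Lambda), 0 <= c /\
  [/\ forall n, (n0 <= n)%N -> step_sup [set: Lambda] n f = step_sup L0 n f,
      gen_sup [set: Lambda] f = gen_sup L0 f
    & [/\ (ereal_sup [set ereal_sup [set etan n l | l in L0] | n in [set: nat]]
           < +oo)%E,
          forall n, (n0 <= n)%N ->
            (ereal_sup [set knorm kappa (I n l f \- f)%R | l in L0]
             <= (c * h n)%:E)%E,
          forall K : set V, compact K ->
            ereal_sup [set supnorm K (diff_quot l f n \- gen l f) | l in L0]
              @[n --> \oo] --> 0%E
        & ereal_sup [set `|etan n l - eta l|%E | l in L0]
              @[n --> \oo] --> 0%E]].

Definition envelope_conditions (omega : R) (lam0 : nat -> Lambda) : Prop :=
  base_conditions omega lam0 /\ (envelope_derivative \/ generator_condition).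

Definition holder_stability (omega alpha : R) : Prop :=
  forall n l f, holder_space kappa alpha f ->
  (holder_norm kappa alpha (I n l f)
   <= (expR (omega * h n))%:E * holder_norm kappa alpha f)%E.

Definition totally_bounded (S : metricType R) : Prop :=
  forall e : R, 0 < e -> exists F : set S,
    finite_set F /\ [set: S] `<=` \bigcup_(s in F) ball s e.

(* The metric space Lambda_r, included in Lambda, is given as a metricType S
   with an injection iota; Lambda_r is then the range of iota. *)
Definition parameter_compactness (alpha : R) (lam0 : nat -> Lambda) : Prop :=
  forall r : R, 0 <= r ->
  exists (S : metricType R) (iota : S -> Lambda),
  [/\ injective iota,
      totally_bounded S,
      forall n f, holder_ball kappa alpha r f ->
        step_sup [set: Lambda] n f =
        step_sup (range iota `&` [set l | (etan n l < +oo)%E]) n f,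
      forall eps : R, 0 < eps -> exists delta : R, 0 < delta /\
        forall n f (s1 s2 : S), holder_ball kappa alpha r f ->
          (etan n (iota s1) < +oo)%E -> (etan n (iota s2) < +oo)%E ->
          mdist s1 s2 < delta ->
          (knorm kappa (fun x =>
             (I n (iota s1) f x - fine (etan n (iota s1)) * h n)
             - (I n (iota s2) f x - fine (etan n (iota s2)) * h n))%R < eps%:E)%E
    & forall n, range iota (lam0 n)].

End Operators.

Inductive relu_net {R : realType} :
    forall m n : nat, ('rV[R]_m -> 'rV[R]_n) -> Prop :=
| relu_net_affine m n (W : 'M[R]_(m, n)) (b : 'rV[R]_n) :
    relu_net (fun x => x *m W + b)
| relu_net_relu m : relu_net (fun x : 'rV[R]_m => map_mx (Num.max^~ 0) x)
| relu_net_comp m n p (F : 'rV[R]_m -> 'rV[R]_n) (G : 'rV[R]_n -> 'rV[R]_p) :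
    relu_net F -> relu_net G -> relu_net (G \o F).

Definition envelope_neural {R : realType} {d : nat} {Lambda : Type}
    (kappa : 'rV[R]_d -> R)
    (I : nat -> Lambda -> ('rV[R]_d -> R) -> ('rV[R]_d -> R))
    (lam0 : nat -> Lambda) (n : nat) : set (('rV[R]_d -> R) -> ('rV[R]_d -> R)) :=
  [set Phi | exists (M : nat) (lam : 'I_M.+1 -> Lambda)
                    (phi : 'rV[R]_M.+1 -> 'rV[R]_1),
    [/\ (0 < M)%N,
        lam ord0 = lam0 n,
        relu_net phi
      & forall f, Ck kappa f -> Ck kappa (Phi f) /\
          Phi f = (fun x => phi (\row_i I n (lam i) f x) ord0 ord0)]].

(* Main.v *)
Require Import Defs.
From mathcomp Require Import all_boot all_order all_algebra.
From mathcomp Require Import all_classical all_reals all_analysis.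
From mathcomp Require Import ring lra.
Import Order.TTheory GRing.Theory Num.Theory.
Import numFieldNormedType.Exports.
Local Open Scope classical_set_scope.
Local Open Scope ring_scope.

(** Fix [n] and write [u f l x := I n l f x - etan n l * h n].  On the Hölder
    ball of radius [r] the envelope is the pointwise supremum over [l] of the
    functions [u f l], where [l] ranges over a totally bounded set of parameters
    with finite penalty, and [l |-> u f l] is uniformly continuous for the
    weighted sup norm, uniformly in [f].  Replacing the parameter set by a finite
    net [lam 0, ..., lam M] with [lam 0 = lam0 n] therefore changes the supremum
    by little in the weighted sup norm ([pointwise_sup_close]).  A finite maximum
    of coordinates shifted by constants is a ReLU network ([relu_net_bigmax]), so
    the resulting operator [Phi] is envelope-neural.

    Smallness in the sup norm upgrades to smallness in the [alpha']-norm by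
    interpolation ([holder_interpolation]): subtracting the constant penalty does
    not affect increments, so by Hölder stability all [u f l] share one
    [alpha]-Hölder bound, uniform in [l] and in [f] from the ball.  Such a bound
    passes to pointwise suprema ([pointwise_sup_holder]), hence to the envelope,
    to [Phi f], and with twice the constant to their difference. *)

(** * ReLU networks computing finite maxima *)

Section ReluMax.
Context {R : realType}.

(** The identity is kept through the activation as [x = relu x - relu (- x)]. *)
Lemma relu_net_residual {m n p : nat} (P : 'M[R]_(m, n)) (D : 'M[R]_(m, p))
    (Q : 'M[R]_(p, n)) :
  relu_net (fun x => x *m P + map_mx (Num.max^~ 0) (x *m D) *m Q).
Proof.
pose W1 := row_mx 1%:M (row_mx (- 1%:M) D) : 'M[R]_(m, m + (m + p)).
pose W2 := col_mx P (col_mx (- P) Q) : 'M[R]_(m + (m + p), n).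
have := relu_net_comp (relu_net_comp (relu_net_affine W1 0)
          (relu_net_relu _)) (relu_net_affine W2 0).
congr (relu_net _); apply/funext => x /=.
rewrite !addr0 /W1 /W2 !mul_mx_row !map_row_mx !mul_row_col addrA.
congr (_ + _); rewrite !mulmxN !mulmx1 -mulNmx -mulmxDl.
congr (_ *m _); apply/rowP => i; rewrite !mxE.
by rewrite /Order.max; case: ifPn; case: ifPn; lra.
Qed.

(** The entry [x 0 0] is the running maximum; each layer compares it with one
    further entry and leaves the other entries unchanged. *)
Lemma relu_net_running_max (M : nat) (s : seq 'I_M) :
  relu_net (fun x : 'rV[R]_M.+1 =>
    \row_i (if i == ord0
            then \big[Num.max/x ord0 ord0]_(j <- s) x ord0 (lift ord0 j)
            else x ord0 i)).
Proof.
elim: s => [|j s IHs].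
  have := relu_net_affine (1%:M : 'M[R]_M.+1) 0.
  congr (relu_net _); apply/funext => x; apply/rowP => i.
  by rewrite addr0 mulmx1 mxE big_nil; case: eqP => [->|].
have := relu_net_comp IHs (relu_net_residual 1%:M
  (delta_mx (lift ord0 j) ord0 - delta_mx ord0 ord0 : 'cV[R]_M.+1)
  (delta_mx ord0 ord0 : 'rV[R]_M.+1)).
congr (relu_net _); apply/funext => x; apply/rowP => i /=.
rewrite mulmx1 mulmxBr -!colE !mxE big_ord1 !mxE /= big_cons.
set b := \big[_/_]_(_ <- _) _.
case: (eqVneq i ord0) => [_|_] /=; last by rewrite mulr0 addr0.
by rewrite mulr1 /Order.max; case: ifPn; case: ifPn; lra.
Qed.

Lemma relu_net_bigmax (M : nat) (c : 'I_M.+1 -> R) :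
  relu_net (fun x : 'rV[R]_M.+1 => const_mx
    (\big[Num.max/x ord0 ord0 - c ord0]_(j < M)
       (x ord0 (lift ord0 j) - c (lift ord0 j))) : 'rV[R]_1).
Proof.
have := relu_net_comp
  (relu_net_comp (relu_net_affine (1%:M : 'M[R]_M.+1) (\row_i (- c i)))
    (relu_net_running_max M (index_enum 'I_M)))
  (relu_net_affine (delta_mx ord0 ord0 : 'cV[R]_M.+1) 0).
congr (relu_net _); apply/funext => x; apply/rowP => i /=.
rewrite addr0 mulmx1 -colE !mxE eqxx /=.
by apply: eq_bigr => j _; rewrite !mxE.
Qed.

End ReluMax.

(** * Weighted norms as real inequalities *)

Section WeightedNorms.
Context {R : realType} {d : nat}.
Local Notation V := 'rV[R]_d.
Implicit Types (f g : V -> R) (kappa : V -> R).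

Lemma knorm_leP kappa f (r : R) :
  (knorm kappa f <= r%:E)%E <-> forall x, `|f x| * kappa x <= r.
Proof.
split=> [H x|H].
  rewrite -lee_fin; apply: le_trans H.
  by apply: ereal_sup_ubound; exists x.
by apply: ge_ereal_sup => _ [x _ <-]; rewrite lee_fin.
Qed.

Lemma knorm_ltyP kappa f :
  (knorm kappa f < +oo)%E <-> exists r, forall x, `|f x| * kappa x <= r.
Proof.
split=> [H|[r /knorm_leP H]]; last exact: le_lt_trans (ltry r).
exists (fine (knorm kappa f)); apply/knorm_leP; rewrite fineK//.
rewrite fin_real// H andbT.
apply: lt_le_trans (ltNyr (`|f 0| * kappa 0)) _.
by apply: ereal_sup_ubound; exists 0.
Qed.

Lemma enorm_gt0 (x : V) : x != 0 -> 0 < enorm x.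
Proof.
move=> x0; rewrite sqrtr_gt0 lt_def sumr_ge0 ?andbT => [|i _]; last exact: sqr_ge0.
apply: contraNneq x0 => /eqP; rewrite psumr_eq0 => [/allP H|i _]; last exact: sqr_ge0.
apply/eqP/rowP => i; rewrite mxE; apply/eqP.
by have := H i (mem_index_enum _); rewrite /= sqrf_eq0.
Qed.

Lemma kbar_gt0 kappa (x y : V) : (forall z, 0 < kappa z) -> 0 < kbar kappa x y.
Proof. by move=> k0; rewrite /kbar divr_gt0 ?addr_gt0 ?mulr_gt0. Qed.

Lemma kbar_lel kappa (x y : V) :
  (forall z, 0 < kappa z) -> kbar kappa x y <= 2 * kappa x.
Proof.
move=> k0; have kx := k0 x; have ky := k0 y.
by rewrite /kbar ler_pdivrMr ?addr_gt0// ler_wpM2l ?mulr_ge0 ?ltW ?ltrDr.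
Qed.

Lemma kbarC kappa (x y : V) : kbar kappa x y = kbar kappa y x.
Proof. by rewrite /kbar (mulrAC 2) addrC. Qed.

Lemma holder_norm_le_knorm kappa a f (r : R) :
  (holder_norm kappa a f <= r%:E)%E -> forall x, `|f x| * kappa x <= r.
Proof. by rewrite ge_max => /andP[/knorm_leP]. Qed.

Lemma holder_norm_le_incr kappa a f (r : R) : 0 <= r ->
  (holder_norm kappa a f <= r%:E)%E ->
  forall x y, `|f x - f y| * kbar kappa x y <= r * enorm (x - y) `^ a.
Proof.
move=> r0; rewrite ge_max => /andP[_ H] x y.
have [->|xy] := eqVneq x y.
  by rewrite subrr normr0 mul0r mulr_ge0 ?powR_ge0.
have D0 : 0 < enorm (x - y) `^ a by rewrite powR_gt0// enorm_gt0// subr_eq0.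
rewrite -ler_pdivrMr// mulrAC -lee_fin; apply: le_trans H.
by apply: ereal_sup_ubound; exists (x, y).
Qed.

(** Interpolation: along functions with a common [a]-Hölder bound, a small
    weighted sup norm forces a small [a']-Hölder norm for every [a' < a]. *)
Lemma holder_interpolation kappa (a a' C e : R) :
  (forall x, 0 < kappa x) -> 0 <= a' < a -> 0 <= C -> 0 < e ->
  exists2 e' : R, 0 < e' & forall g,
    (forall x, `|g x| * kappa x <= e') ->
    (forall x y, `|g x - g y| * kbar kappa x y <= C * enorm (x - y) `^ a) ->
    (holder_norm kappa a' g <= e%:E)%E.
Proof.
move=> k0 /andP[a'0 a'a] C0 e0.
have t0 : 0 < a - a' by rewrite subr_gt0.
have C1 : 0 < C + 1 by lra.
(* [rho] separates short increments, controlled by the [a]-Hölder bound, from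
   long ones, controlled by the sup norm. *)
pose rho := (e / (C + 1)) `^ (a - a')^-1.
have rho0 : 0 < rho by rewrite powR_gt0// divr_gt0.
have rhot : rho `^ (a - a') = e / (C + 1).
  by rewrite -powRrM mulVf ?gt_eqF// powRr1// divr_ge0 ?ltW.
have ra0 : 0 < rho `^ a' by exact: powR_gt0.
exists (Num.min e (e * rho `^ a' / 4)).
  by rewrite lt_min e0 divr_gt0 ?mulr_gt0.
move=> g gk gh; rewrite ge_max; apply/andP; split.
  by apply/knorm_leP => x; apply: le_trans (gk x) _; rewrite ge_min lexx.
apply: ge_ereal_sup => _ [[x y]/= xy <-]; rewrite lee_fin.
have D0 : 0 < enorm (x - y) by rewrite enorm_gt0// subr_eq0.
set D := enorm (x - y) in D0 *.
have Da0 : 0 < D `^ a' by exact: powR_gt0.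
rewrite mulrAC ler_pdivrMr//.
have [Drho|rhoD] := leP D rho.
  apply: le_trans (gh x y) _; rewrite -/D.
  have -> : D `^ a = D `^ (a - a') * D `^ a'.
    by rewrite -powRD ?subrK// (gt_eqF D0) implybT.
  rewrite mulrA ler_wpM2r ?powR_ge0//.
  apply: (@le_trans _ _ (C * (e / (C + 1)))).
    by rewrite ler_wpM2l// -rhot ge0_ler_powR ?nnegrE // ltW.
  by rewrite mulrA ler_pdivrMr//; nra.
apply: (@le_trans _ _ (e * rho `^ a')); last first.
  by rewrite ler_wpM2l ?(ltW e0)// ge0_ler_powR ?nnegrE // ltW.
have g4 z : `|g z| * kappa z <= e * rho `^ a' / 4.
  by apply: le_trans (gk z) _; rewrite ge_min lexx orbT.
have kx : `|g x| * kbar kappa x y <= `|g x| * (2 * kappa x).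
  by rewrite ler_wpM2l// kbar_lel.
have ky : `|g y| * kbar kappa x y <= `|g y| * (2 * kappa y).
  by rewrite ler_wpM2l// kbarC kbar_lel.
have := ler_wpM2r (ltW (kbar_gt0 kappa x y k0)) (ler_normB (g x) (g y)).
have := g4 x; have := g4 y; lra.
Qed.

End WeightedNorms.

(** * Stability of the weighted space under finite maxima *)

Section CkMax.
Context {R : realType} {d : nat}.
Local Notation V := 'rV[R]_d.
Implicit Types (f g : V -> R) (kappa : V -> R).

Lemma Ck_subr_cst kappa f (c : R) :
  weight kappa -> Ck kappa f -> Ck kappa (fun x => f x - c).
Proof.
move=> [k0 _ [B kB] _] [fc /knorm_ltyP[r fr]]; split.
  by move=> x; exact: (cvgB (fc x) (cvg_cst _)).
apply/knorm_ltyP; exists (r + `|c| * B) => x.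
apply: le_trans (ler_wpM2r (ltW (k0 x)) (ler_normB _ _)) _.
by rewrite mulrDl lerD// ler_wpM2l.
Qed.

Lemma Ck_max kappa f g : (forall x, 0 < kappa x) ->
  Ck kappa f -> Ck kappa g -> Ck kappa (fun x => Num.max (f x) (g x)).
Proof.
move=> k0 [fc /knorm_ltyP[r fr]] [gc /knorm_ltyP[s gs]]; split.
  by move=> x; exact: (continuous_max (fc x) (gc x)).
apply/knorm_ltyP; exists (Num.max r s) => x; rewrite le_max.
by rewrite /Order.max; case: ifP => _; rewrite ?fr ?gs ?orbT.
Qed.

Lemma Ck_bigmax kappa (T : Type) (s : seq T) f (F : T -> V -> R) :
  (forall x, 0 < kappa x) -> Ck kappa f -> (forall i, Ck kappa (F i)) ->
  Ck kappa (fun x => \big[Num.max/f x]_(i <- s) F i x).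
Proof.
move=> k0 fC FC; elim: s => [|i s IHs].
  by rewrite (_ : (fun x => _) = f)//; apply/funext => x; rewrite big_nil.
have := Ck_max _ _ _ k0 (FC i) IHs; congr (Ck kappa _).
by apply/funext => x; rewrite big_cons.
Qed.

End CkMax.

(** * Pointwise suprema *)

(** [E] is the pointwise least upper bound of the family [u l], [l] in [L]. *)
Definition pointwise_sup {R : realType} {T X : Type} (L : set T)
    (u : T -> X -> R) (E : X -> R) : Prop :=
  forall x, (forall l, L l -> u l x <= E x) /\
            (forall b, (forall l, L l -> u l x <= b) -> E x <= b).

Section PointwiseSup.
Context {R : realType} {T X : Type}.
Implicit Types (L : set T) (u : T -> X -> R) (E : X -> R).

Lemma pointwise_sup_ereal_sup L u (b : X -> R) : L !=set0 ->
  (forall l x, L l -> u l x <= b x) ->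
  pointwise_sup L u (fun x => fine (ereal_sup [set (u l x)%:E | l in L])).
Proof.
move=> [l0 Ll0] ub x; set s := ereal_sup _.
have us l : L l -> ((u l x)%:E <= s)%E.
  by move=> Ll; apply: ereal_sup_ubound; exists l.
have sle c : (forall l, L l -> u l x <= c) -> (s <= c%:E)%E.
  by move=> H; apply: ge_ereal_sup => _ [l Ll <-]; rewrite lee_fin H.
have sfin : s \is a fin_num.
  rewrite fin_real// (lt_le_trans (ltNyr _) (us _ Ll0)).
  by rewrite (le_lt_trans (sle (b x) _) (ltry _))// => l; exact: ub.
split=> [l /us|c /sle]; first by rewrite -{1}(fineK sfin) lee_fin.
by rewrite -{1}(fineK sfin) lee_fin.
Qed.

Lemma pointwise_sup_bigmax (M : nat) (lam : 'I_M.+1 -> T) u :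
  pointwise_sup (range lam) u
    (fun x => \big[Num.max/u (lam ord0) x]_(j < M) u (lam (lift ord0 j)) x).
Proof.
move=> x; split=> [_ [i _ <-]|b H].
  case: (unliftP ord0 i) => [j ->|->]; first exact: le_bigmax.
  exact: bigmax_ge_id.
by apply: bigmax_le => [|j _]; apply: H; eexists.
Qed.

Lemma pointwise_sup_close L L' u E E' (kappa : X -> R) (e : R) :
  (forall x, 0 < kappa x) -> L' `<=` L ->
  (forall l, L l -> exists2 l', L' l' &
     forall x, `|u l x - u l' x| * kappa x <= e) ->
  pointwise_sup L u E -> pointwise_sup L' u E' ->
  forall x, `|E x - E' x| * kappa x <= e.
Proof.
move=> k0 L'L net hE hE' x.
have E'E : E' x <= E x.
  by apply: (hE' x).2 => l /L'L; exact: (hE x).1.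
rewrite ger0_norm ?subr_ge0// -ler_pdivlMr// lerBlDl.
apply: (hE x).2 => l /net[l' Ll' /(_ x)].
rewrite -ler_pdivlMr// => /(le_trans (ler_norm _)).
by have := (hE' x).1 _ Ll'; lra.
Qed.

End PointwiseSup.

Lemma pointwise_sup_holder {R : realType} {d : nat} {T : Type} (L : set T)
    (u : T -> 'rV[R]_d -> R) (E : 'rV[R]_d -> R) (kappa : 'rV[R]_d -> R)
    (a C : R) :
  (forall x, 0 < kappa x) ->
  (forall l x y, L l ->
     `|u l x - u l y| * kbar kappa x y <= C * enorm (x - y) `^ a) ->
  pointwise_sup L u E ->
  forall x y, `|E x - E y| * kbar kappa x y <= C * enorm (x - y) `^ a.
Proof.
move=> k0 uH hE x y; have kb := kbar_gt0 kappa x y k0.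
rewrite -ler_pdivlMr// ler_norml; apply/andP; split.
  rewrite lerNl opprB lerBlDl.
  apply: (hE y).2 => l Ll; have := uH l x y Ll.
  rewrite -ler_pdivlMr// distrC => /(le_trans (ler_norm _)).
  by have := (hE x).1 _ Ll; lra.
rewrite lerBlDl; apply: (hE x).2 => l Ll; have := uH l x y Ll.
rewrite -ler_pdivlMr// => /(le_trans (ler_norm _)).
by have := (hE y).1 _ Ll; lra.
Qed.

(** * Approximation of the envelope *)

(** Centres whose ball meets the subset are moved into it, at the cost of doubling
    the radius; the other centres are irrelevant and go to an arbitrary point of
    the subset. *)
Lemma totally_bounded_subset_net {R : realType} (S : metricType R) (A : set S)
    (e : R) : totally_bounded S -> 0 < e -> A !=set0 ->
  exists2 t : seq S, (forall s, s \in t -> A s) &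
    forall s, A s -> exists2 s', s' \in t & mdist s s' < e.
Proof.
move=> tb e0 [s0 As0].
have e20 : 0 < e / 2 by rewrite divr_gt0.
have [F [/finite_seqP[t ->] cov]] := tb _ e20.
pose g c := xget s0 (A `&` ball c (e / 2)).
exists [seq g c | c <- t].
  by move=> _ /mapP[c _ ->]; rewrite /g; case: xgetP => [? _ []|].
move=> s As; have [c ct cs] := cov s Logic.I.
exists (g c); first exact: map_f.
have [_ cg] : (A `&` ball c (e / 2)) (g c) by apply: (xgetPex s0); exists s.
have /= : ball s e (g c) by apply: (ball_splitr cs cg).
by rewrite ballEmdist.
Qed.

Theorem theorem4p6 (R : realType) (d : nat) (Lambda : Type)
    (kappa : 'rV[R]_d -> R)
    (I : nat -> Lambda -> ('rV[R]_d -> R) -> ('rV[R]_d -> R))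
    (eta : Lambda -> \bar R) (etan : nat -> Lambda -> \bar R)
    (h : nat -> R) (omega : R) (lam0 : nat -> Lambda) (alpha : R) :
  weight kappa ->
  operator_setting kappa I eta etan h ->
  0 < alpha <= 1 ->
  envelope_conditions kappa I eta etan h omega lam0 ->
  holder_stability kappa I h omega alpha ->
  parameter_compactness kappa I etan h alpha lam0 ->
  forall (n : nat) (r alpha' eps : R),
    0 <= r -> 0 <= alpha' < alpha -> 0 < eps ->
    exists Phi : ('rV[R]_d -> R) -> ('rV[R]_d -> R),
      envelope_neural kappa I lam0 n Phi /\
      (ereal_sup [set holder_norm kappa alpha' (envelope I etan h n f \- Phi f)%R
                 | f in holder_ball kappa alpha r] < eps%:E)%E.
Proof.
move=> hw [ICk _ etan0 h0 _] _ [[pen _ _ _ _ _ _ _] _] hstab hcomp.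
move=> n r alpha' eps r0 aa' eps0.
have k0 : forall x, 0 < kappa x by case: hw.
pose C := expR (omega * h n) * r.
have C0 : 0 <= C by rewrite mulr_ge0// expR_ge0.
have C20 : 0 <= C + C by rewrite addr_ge0.
have eps20 : 0 < eps / 2 by rewrite divr_gt0.
have [e' e'0 interp] := holder_interpolation _ _ _ _ _ k0 aa' C20 eps20.
have [S [iota [_ tb supE lip lam0S]]] := hcomp r r0.
have [delta [delta0 close]] := lip _ e'0.
pose A : set S := [set s | (etan n (iota s) < +oo)%E].
have [s0 _ s0E] := lam0S n.
have As0 : A s0 by rewrite /A /= s0E pen ltry.
have [t tA tnet] :=
  totally_bounded_subset_net _ _ _ tb delta0 (ex_intro _ s0 As0 : A !=set0).
(* [s0] is listed once more, so that at least one parameter follows the first. *)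
pose M := (size t).+1.
pose s_ (i : 'I_M.+1) : S := nth s0 (s0 :: s0 :: t) i.
have s_A i : A (s_ i).
  have : s_ i \in s0 :: s0 :: t by apply: mem_nth.
  by rewrite !inE => /or3P[/eqP->|/eqP->|/tA].
have s_net s : A s -> exists i, mdist s (s_ i) < delta.
  move=> /tnet[s' s't ss'].
  have lt_i : ((index s' t).+2 < M.+1)%N by rewrite !ltnS index_mem.
  by exists (Ordinal lt_i); rewrite /s_ /= nth_index.
pose lam i := iota (s_ i).
pose c l := fine (etan n l) * h n.
pose u f l x := I n l f x - c l.
pose L : set Lambda := range iota `&` [set l | (etan n l < +oo)%E].
have lamL : range lam `<=` L.
  by move=> _ [i _ <-]; split; [exists (s_ i)|exact: s_A].
exists (fun f x =>
  \big[Num.max/u f (lam ord0) x]_(j < M) u f (lam (lift ord0 j)) x).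
split.
  exists M, lam; eexists; split=> //; first exact: (relu_net_bigmax M (c \o lam)).
  move=> f fC; split.
    by apply: Ck_bigmax => // [|i]; apply: Ck_subr_cst => //; exact: ICk.
  apply/funext => x; rewrite !mxE; apply: eq_bigr => j _.
  by rewrite !mxE.
apply: (@le_lt_trans _ _ (eps / 2)%:E); last by rewrite lte_fin; lra.
apply: ge_ereal_sup => _ [f fB <-].
have [fS fr] := fB.
have IC l : (holder_norm kappa alpha (I n l f) <= C%:E)%E.
  apply: le_trans (hstab n l f fS) _.
  by rewrite EFinM lee_wpmul2l// lee_fin expR_ge0.
have uH l x y : `|u f l x - u f l y| * kbar kappa x y <= C * enorm (x - y) `^ alpha.
  rewrite /u (_ : _ - _ - (_ - _) = I n l f x - I n l f y); last by ring.
  exact: holder_norm_le_incr.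
have envE : pointwise_sup L (u f) (envelope I etan h n f).
  have -> : envelope I etan h n f =
      fun x => fine (ereal_sup [set (u f l x)%:E | l in L]).
    apply/funext => x; rewrite /envelope supE// /step_sup; congr (fine (ereal_sup _)).
    apply: eq_imagel => l [_ /= lfin].
    by rewrite /u /c EFinB EFinM fineK// ge0_fin_numE.
  apply: (@pointwise_sup_ereal_sup _ _ _ _ _ (fun x => C / kappa x)).
    by exists (lam ord0); apply: lamL; exists ord0.
  move=> l x _; apply: (@le_trans _ _ (I n l f x)).
    by rewrite gerBl mulr_ge0 ?fine_ge0// ltW.
  rewrite ler_pdivlMr//; have := holder_norm_le_knorm _ _ _ _ (IC l) x.
  by apply: le_trans; rewrite ler_wpM2r ?ler_norm// ltW.
have PhiE := pointwise_sup_bigmax M lam (u f).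
apply: interp => [|x y].
  apply: (pointwise_sup_close _ _ _ _ _ _ _ k0 lamL _ envE PhiE) => _ [[s _ <-] /= sA].
  have [i si] := s_net s sA; exists (lam i); first by exists i.
  by apply/knorm_leP/ltW; apply: close => //; exact: s_A.
have := pointwise_sup_holder _ _ _ _ _ _ k0 (fun l x y _ => uH l x y) envE x y.
have := pointwise_sup_holder _ _ _ _ _ _ k0 (fun l x y _ => uH l x y) PhiE x y.
rewrite /=; set e1 := envelope _ _ _ _ _ x; set e2 := envelope _ _ _ _ _ y.
set p1 := \big[_/_]_(_ < _) _; set p2 := \big[_/_]_(_ < _) _ => hp he.
have := ler_wpM2r (ltW (kbar_gt0 kappa x y k0)) (ler_normB (e1 - e2) (p1 - p2)).
rewrite (_ : e1 - e2 - (p1 - p2) = e1 - p1 - (e2 - p2)); last by ring.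
lra.
Qed.
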